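(* Let $A,P\in\mathbb{R}^{n\times n}$ be invertible and $b\in\mathbb{R}^n$. Consider NGMRES($m$) used to accelerate the preconditioned Richardson iteration $q(x)=x+P(b-Ax)$ for solving $g(x)=Ax-b=0$, and right-preconditioned GMRES with right preconditioner $P$ for solving $Ax=b$. Assume that either $(AP)^T=AP$, or $AP=\tau I+S$ with $\tau\in\mathbb{R}$ and $S^T=-S$, and that both methods use the same initial guess $x_0$. Let $\{x_i^{NG(m)}\}$ and $\{x_i^{Gr}\}$ be the sequences generated by NGMRES($m$) and right-preconditioned GMRES, respectively, and let $\bar r_i^{Gr}=Ax_i^{Gr}-b$. Assume that for some $k^*\in\mathbb{Z}^+$, $\bar r^{Gr}_{k^*-1}\neq0$ and $\|\bar r^{Gr}_k\|<\|\bar r^{Gr}_{k-1}\|$ for all $k\in\mathbb{Z}^+$ with $0<k<k^*$. Then $x_k^{NG(m)}=x_k^{Gr}$ for all $m\in\mathbb{Z}^+$ and all $0\le k\le k^*$.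
   Context: $\|\cdot\|$ is the Euclidean 2-norm and $\mathbb{Z}^+$ is the set of positive integers. NGMRES($m$): given $x_0\in\mathbb{R}^n$, for $k=0,1,2,\dots$ let $m_k=\min\{k,m\}$ and set $$x_{k+1}=q(x_k)+\sum_{i=0}^{m_k}\beta_i^{(k)}\big(q(x_k)-x_{k-i}\big),$$ where $\boldsymbol{\beta}^{(k)}=(\beta_0^{(k)},\dots,\beta_{m_k}^{(k)})\in\mathbb{R}^{m_k+1}$ is a minimizer of $$\Big\|g(q(x_k))+\sum_{i=0}^{m_k}\beta_i^{(k)}\big(g(q(x_k))-g(x_{k-i})\big)\Big\|^2 .$$ Right-preconditioned GMRES with preconditioner $P$ and initial guess $x_0$: let $\bar r_0=Ax_0-b$ and $\mathcal{K}_k(AP,\bar r_0)=\mathrm{span}\{\bar r_0,AP\bar r_0,\dots,(AP)^{k-1}\bar r_0\}$. Then $x_0^{Gr}=x_0$ and, for $k\ge1$, $x_k^{Gr}=x_0+Pz_k$, where $z_k\in\mathcal{K}_k(AP,\bar r_0)$ minimizes $\|\bar r_0+APz\|$ over $z\in\mathcal{K}_k(AP,\bar r_0)$. *)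

(* Defs.v *)
From mathcomp Require Import all_boot all_order all_algebra.
From mathcomp Require Import reals.

Set Implicit Arguments.
Unset Strict Implicit.
Unset Printing Implicit Defensive.

Import Order.TTheory GRing.Theory Num.Theory.
Local Open Scope ring_scope.

(* The norm that MathComp-Analysis puts on matrices is the max norm, hence an
   explicit 2-norm. *)
Definition norm2 (R : realType) (n : nat) (v : 'cV[R]_n) : R :=
  Num.sqrt (\sum_(i < n) v i 0 ^+ 2).

Definition residual (R : realType) (n : nat) (A : 'M[R]_n) (b x : 'cV[R]_n) :
    'cV[R]_n :=
  A *m x - b.

Definition richardson (R : realType) (n : nat) (A P : 'M[R]_n)
    (b x : 'cV[R]_n) : 'cV[R]_n :=
  x + P *m (b - A *m x).

(* ngmres_update and ngmres_objective are used with l = minn k m <= k, so that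
   k - i is never truncated. *)
Definition ngmres_update (R : realType) (n : nat) (q : 'cV[R]_n -> 'cV[R]_n)
    (x : nat -> 'cV[R]_n) (k l : nat) (beta : 'cV[R]_l.+1) : 'cV[R]_n :=
  q (x k) + \sum_(i < l.+1) beta i 0 *: (q (x k) - x (k - i)%N).

Definition ngmres_objective (R : realType) (n : nat)
    (q g : 'cV[R]_n -> 'cV[R]_n) (x : nat -> 'cV[R]_n) (k l : nat)
    (beta : 'cV[R]_l.+1) : R :=
  norm2 (g (q (x k))
         + \sum_(i < l.+1) beta i 0 *: (g (q (x k)) - g (x (k - i)%N))) ^+ 2.

(* A relation and not a function: the least-squares problem may have several
   minimizers, and the method may pick any of them at each step. *)
Definition is_ngmres (R : realType) (n m : nat) (q g : 'cV[R]_n -> 'cV[R]_n)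
    (x0 : 'cV[R]_n) (x : nat -> 'cV[R]_n) : Prop :=
  x 0%N = x0 /\
  forall k : nat, exists beta : 'cV[R]_(minn k m).+1,
    (forall gamma : 'cV[R]_(minn k m).+1,
       ngmres_objective q g x k beta <= ngmres_objective q g x k gamma) /\
    x k.+1 = ngmres_update q x k beta.

Definition krylov (R : realType) (n : nat) (M : 'M[R]_n) (r : 'cV[R]_n)
    (k : nat) : {vspace 'cV[R]_n} :=
  <<[seq M ^+ j *m r | j <- iota 0 k]>>%VS.

Definition is_right_gmres (R : realType) (n : nat) (A P : 'M[R]_n)
    (b x0 : 'cV[R]_n) (x : nat -> 'cV[R]_n) : Prop :=
  let r0 := residual A b x0 in
  x 0%N = x0 /\
  forall k : nat, (0 < k)%N -> exists z : 'cV[R]_n,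
    [/\ z \in krylov (A *m P) r0 k,
        forall y : 'cV[R]_n, y \in krylov (A *m P) r0 k ->
          norm2 (r0 + A *m P *m z) <= norm2 (r0 + A *m P *m y)
      & x k = x0 + P *m z].

(* Main.v *)
Require Import Defs.
From mathcomp Require Import all_boot all_order all_algebra.
From mathcomp Require Import reals.
From mathcomp Require Import ring.

Set Implicit Arguments.
Unset Strict Implicit.
Unset Printing Implicit Defensive.

Import Order.TTheory GRing.Theory Num.Theory.
Local Open Scope ring_scope.

(** Put M = A P and let K_k be the k-th Krylov space of M and of the initial
    residual r_0. Since A is invertible, an iterate is determined by its
    residual, so only residuals have to be compared. The k-th GMRES residual
    is r_k = r_0 + M z_k with z_k in K_k, characterised by r_k being
    orthogonal to M K_k.

    The residual of q(x_k) is r_k - M r_k. Hence, if NGMRES and GMRES agree up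
    to step k, the next NGMRES residual minimises the norm over the affine
    space through r_k directed by M r_k and by the differences r_k - r_(k-i),
    1 <= i <= m_k. This space lies in r_0 + M K_(k+1), over which GMRES
    minimises ([ngmres_update_krylov]), and a minimiser over the larger space
    has a unique residual ([minres_unique]). So it is enough that the GMRES
    residual r_(k+1) lies in the NGMRES space, and this already happens with
    the single difference r_k - r_(k-1): GMRES satisfies a three-term
    recurrence ([minres_three_term]). For k = 0 there is no difference to use,
    but then M r_0 alone spans M K_1.

    For the recurrence, let d = z_k - z_(k-1). Because M d = r_k - r_(k-1) is
    nonzero and orthogonal to M K_(k-1), the vector d is not in K_(k-1); this
    forces K_(k+1) to be spanned by K_(k-1), d and r_k
    ([krylov_span_residual]), so that r_(k+1) - r_k is a combination of M d,
    M r_k and some M u with u in K_(k-1). Both hypotheses on M make its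
    transpose an affine function of M, whence M^T M u lies in M K_k and M r_k
    is orthogonal to M u. The vectors r_(k+1) - r_k and M d are orthogonal to
    M u as well, so M u is orthogonal to itself and vanishes. *)

(** * The Euclidean inner product *)

Definition dot (R : realType) (n : nat) (u v : 'cV[R]_n) : R :=
  (u^T *m v) 0 0.

Section InnerProduct.
Variables (R : realType) (n : nat).
Implicit Types (u v w : 'cV[R]_n) (M : 'M[R]_n).

Lemma dotC u v : dot u v = dot v u.
Proof. by rewrite /dot -[u^T *m v]trmxK trmx_mul trmxK mxE. Qed.

Lemma dotDr u v w : dot u (v + w) = dot u v + dot u w.
Proof. by rewrite /dot mulmxDr mxE. Qed.

Lemma dotZr a u v : dot u (a *: v) = a * dot u v.
Proof. by rewrite /dot -scalemxAr mxE. Qed.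

Lemma dotDl u v w : dot (u + v) w = dot u w + dot v w.
Proof. by rewrite dotC dotDr !(dotC w). Qed.

Lemma dotZl a u v : dot (a *: u) v = a * dot u v.
Proof. by rewrite dotC dotZr dotC. Qed.

Lemma dotBl u v w : dot (u - v) w = dot u w - dot v w.
Proof. by rewrite dotDl -scaleN1r dotZl mulN1r. Qed.

Lemma dot_mulmxl M u v : dot (M *m u) v = dot u (M^T *m v).
Proof. by rewrite /dot trmx_mul mulmxA. Qed.

Lemma dotvvE v : dot v v = \sum_i v i 0 ^+ 2.
Proof. by rewrite /dot mxE; apply: eq_bigr => i _; rewrite mxE expr2. Qed.

Lemma dotvv_ge0 v : 0 <= dot v v.
Proof. by rewrite dotvvE sumr_ge0 // => i _; apply: sqr_ge0. Qed.

Lemma dotvv_le0 v : dot v v <= 0 -> v = 0.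
Proof.
move=> v_le0; apply/matrixP => i j; rewrite ord1 mxE; apply/eqP.
rewrite -sqrf_eq0; move: v_le0; rewrite dotvvE => v_le0.
have /eqP : \sum_i v i 0 ^+ 2 = 0.
  by apply/eqP; rewrite eq_le v_le0 sumr_ge0 // => k _; apply: sqr_ge0.
rewrite psumr_eq0 => [/allP/(_ i)|k _]; last exact: sqr_ge0.
by apply; rewrite mem_index_enum.
Qed.

Lemma norm2_sqr v : norm2 v ^+ 2 = dot v v.
Proof. by rewrite /norm2 -dotvvE sqr_sqrtr ?dotvv_ge0. Qed.

Lemma norm2_le u v : (norm2 u <= norm2 v) = (dot u u <= dot v v).
Proof. by rewrite /norm2 -!dotvvE ler_sqrt ?dotvv_ge0. Qed.

(** The first-order condition for minimality along a line: otherwise the step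
    of length - <v, w> / <w, w>, which projects v onto the orthogonal of w,
    would decrease the norm. *)
Lemma minimal_orthogonal v w :
  (forall t, dot v v <= dot (v + t *: w) (v + t *: w)) -> dot v w = 0.
Proof.
move=> vmin; have [w0|wN0] := eqVneq (dot w w) 0.
  by have -> : w = 0; [apply: dotvv_le0; rewrite w0 | rewrite /dot mulmx0 mxE].
have w_gt0 : 0 < dot w w by rewrite lt_def wN0 dotvv_ge0.
have := vmin (- (dot v w / dot w w)).
rewrite !(dotDl, dotDr, dotZl, dotZr) (dotC w v).
set p := dot v w; set s := dot w w in wN0 w_gt0 *.
have -> : dot v v + - (p / s) * p + (- (p / s) * p + - (p / s) * (- (p / s) * s))
   = dot v v - p ^+ 2 / s by field.
rewrite lerDl oppr_ge0 pmulr_lle0 ?invr_gt0 // => p2_le0.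
by apply/eqP; rewrite -sqrf_eq0 eq_le p2_le0 sqr_ge0.
Qed.

End InnerProduct.

(** * Minimal residuals over Krylov spaces *)

Section Krylov.
Variables (R : realType) (n : nat) (M : 'M[R]_n) (r : 'cV[R]_n).
Local Notation K := (krylov M r).

Lemma krylovS k : K k.+1 = (K k + <[M ^+ k *m r]>)%VS.
Proof.
(* Rewriting with addn1 in the goal would also hit the column type. *)
have iotaS : iota 0 k.+1 = iota 0 k ++ [:: k] by rewrite -addn1 iotaD.
by rewrite /krylov iotaS map_cat span_cat /= span_seq1.
Qed.

Lemma memv_krylovS k y :
  y \in K k.+1 -> exists2 y', y' \in K k & exists c, y = y' + c *: (M ^+ k *m r).
Proof.
rewrite krylovS => /memv_addP[y' Ky' [_ /vlineP[c ->] ->]].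
by exists y' => //; exists c.
Qed.

Lemma krylov_mono k l y : (k <= l)%N -> y \in K k -> y \in K l.
Proof.
move=> /subnKC <- Ky; elim: (l - k)%N => [|i IH]; first by rewrite addn0.
by rewrite addnS krylovS (subvP (addvSl _ _)).
Qed.

Lemma krylov_power k : M ^+ k *m r \in K k.+1.
Proof. by rewrite krylovS (subvP (addvSr _ _)) ?memv_line. Qed.

Lemma mulmx_power k : M *m (M ^+ k *m r) = M ^+ k.+1 *m r.
Proof. by rewrite mulmxA exprS. Qed.

Lemma krylov0 y : y \in K 0 -> y = 0.
Proof. by rewrite /krylov span_nil memv0 => /eqP. Qed.

Lemma mulmx_krylov k y : y \in K k -> M *m y \in K k.+1.
Proof.
elim: k y => [|k IH] y; first by move/krylov0->; rewrite mulmx0 mem0v.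
move=> /memv_krylovS[y' /IH Ky' [c ->]].
rewrite mulmxDr -scalemxAr mulmx_power memvD ?memvZ ?krylov_power //.
exact: krylov_mono Ky'.
Qed.

Lemma krylov_residual k z : z \in K k -> r + M *m z \in K k.+1.
Proof.
move=> /mulmx_krylov Kz; rewrite memvD //.
by have /(krylov_mono (ltn0Sn k)) := krylov_power 0; rewrite expr0 mul1mx.
Qed.

(** The normal equations of the least-squares problem solved by GMRES, in place
    of the minimality itself: they are what the recurrence below consumes. *)
Definition is_minres k z :=
  z \in K k /\ forall y, y \in K k -> dot (r + M *m z) (M *m y) = 0.

Lemma shifted_image_sub u v : (r + M *m u) - (r + M *m v) = M *m (u - v).
Proof. by rewrite mulmxBr opprD addrACA subrr add0r. Qed.

Lemma minresP k z : z \in K k ->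
  (forall y, y \in K k -> norm2 (r + M *m z) <= norm2 (r + M *m y)) ->
  is_minres k z.
Proof.
move=> Kz zmin; split=> // y Ky; apply: minimal_orthogonal => t.
rewrite -norm2_le -addrA scalemxAr -mulmxDr.
by apply: zmin; rewrite memvD ?memvZ.
Qed.

(** Pythagoras: the squared norm of r + M y exceeds the minimum by the squared
    norm of M (y - z). Only the residual is unique, as M may have a kernel. *)
Lemma minres_unique k z y : is_minres k z -> y \in K k ->
  dot (r + M *m y) (r + M *m y) <= dot (r + M *m z) (r + M *m z) ->
  r + M *m y = r + M *m z.
Proof.
move=> [Kz zorth] Ky.
have Kyz : y - z \in K k by rewrite rpredB.
have -> : r + M *m y = r + M *m z + M *m (y - z).
  by rewrite -shifted_image_sub subrKC.
have := zorth _ Kyz; move: (M *m (y - z)) (r + M *m z) => w v vw0.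
rewrite dotDl !dotDr (dotC w v) vw0 addr0 add0r gerDl => /dotvv_le0->.
by rewrite addr0.
Qed.

Lemma minres_step_orthogonal k z z' y : is_minres k z -> is_minres k.+1 z' ->
  y \in K k -> dot (M *m (z' - z)) (M *m y) = 0.
Proof.
move=> [_ zo] [_ zo'] Ky.
by rewrite -shifted_image_sub dotBl zo // zo' ?subrr // (krylov_mono _ Ky).
Qed.

(** Strict progress between two steps means that z' - z has a nonzero component
    on M ^+ k r, so it can replace this power as the new direction of K k.+1;
    applying M then lets the residual r + M z' replace M ^+ k.+1 r. *)
Lemma krylov_span_residual k z z' :
  is_minres k z -> is_minres k.+1 z' -> M *m (z' - z) != 0 ->
  (K k.+2 <= K k + <[z' - z]> + <[r + M *m z']>)%VS.
Proof.
move=> hz hz' dN0; have [[Kz _] [Kz' _]] := (hz, hz').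
have Kd : z' - z \in K k.+1 by rewrite rpredB // (krylov_mono _ Kz).
have [d' Kd' [e dE]] := memv_krylovS Kd.
(* If e = 0 then z' - z is in K k, and M (z' - z) is orthogonal to itself. *)
have eN0 : e != 0.
  apply: contra_neq dN0 => e0; apply: dotvv_le0.
  by rewrite (minres_step_orthogonal hz hz') // dE e0 scale0r addr0.
have powE : M ^+ k *m r = e^-1 *: (z' - z) - e^-1 *: d'.
  by rewrite dE -scalerBr [d' + _]addrC addrK scalerA mulVf ?scale1r.
have KS : (K k.+1 <= K k + <[z' - z]>)%VS.
  rewrite krylovS subv_add addvSl -memvE powE addrC.
  by rewrite memv_add ?rpredN ?memvZ ?memv_line.
apply: subv_trans (addvS KS (subvv _)).
rewrite [K k.+2]krylovS subv_add addvSl -memvE -mulmx_power powE.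
have -> : M *m (e^-1 *: (z' - z) - e^-1 *: d') =
    - (e^-1 *: (r + M *m z) + e^-1 *: (M *m d')) + e^-1 *: (r + M *m z').
  rewrite mulmxBr -!scalemxAr mulmxBr.
  by apply/matrixP => i j; rewrite !mxE; ring.
rewrite memv_add ?memvZ ?memv_line // rpredN rpredD ?memvZ //.
  exact: krylov_residual.
exact: mulmx_krylov.
Qed.

(** The direction z'' - z' has components on r + M z', on z' - z and on some u
    in K k. The image of u under M vanishes because it is orthogonal to the
    images of the three other vectors; for r + M z' this is where the
    hypothesis on the transpose enters, since it keeps M^T (M u) in the image
    of K k.+1. *)
Lemma minres_three_term (a c : R) k z z' z'' :
  M^T = a *: M + c%:M ->
  is_minres k z -> is_minres k.+1 z' -> is_minres k.+2 z'' ->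
  M *m (z' - z) != 0 ->
  exists s t, r + M *m z'' =
    r + M *m z' + s *: (M *m (r + M *m z')) + t *: (M *m (z' - z)).
Proof.
move=> MT hz hz' hz'' dN0; have [[Kz' zo'] [Kz'' _]] := (hz', hz'').
have Kd'' : z'' - z' \in K k.+2 by rewrite rpredB // (krylov_mono _ Kz').
have /(subvP (krylov_span_residual hz hz' dN0)) := Kd''.
move=> /memv_addP[_ /memv_addP[u Ku [_ /vlineP[t ->] ->]] [_ /vlineP[s ->] dE]].
have orth : dot (M *m (r + M *m z')) (M *m u) = 0.
  rewrite dot_mulmxl MT mulmxDl mul_scalar_mx -scalemxAl dotDr !dotZr.
  by rewrite !zo' ?mulmx_krylov ?(krylov_mono _ Ku) // !mulr0 addr0.
have Mu0 : M *m u = 0.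
  apply: dotvv_le0.
  have := minres_step_orthogonal hz' hz'' (krylov_mono (leqnSn k) Ku).
  rewrite dE 2!mulmxDr -!scalemxAr !dotDl !dotZl orth.
  by rewrite (minres_step_orthogonal hz hz' Ku) !mulr0 !addr0 => ->.
exists s, t; have -> : z'' = z' + (z'' - z') by rewrite subrKC.
rewrite dE 3!mulmxDr Mu0 add0r -!scalemxAr addrA.
by rewrite -!addrA; congr (_ + (_ + _)); rewrite addrC.
Qed.

End Krylov.

(** * The search space of NGMRES *)

Section NGMRES.
Variables (R : realType) (n : nat) (A P : 'M[R]_n) (b : 'cV[R]_n).
Local Notation g := (residual A b).
Local Notation q := (richardson A P b).
Local Notation M := (A *m P).

Lemma residual_inj : A \in unitmx -> injective g.
Proof. by move=> hA x y /addIr/(can_inj (mulKmx hA)). Qed.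

Lemma residualD x v : g (x + v) = g x + A *m v.
Proof. by rewrite /residual mulmxDr addrAC. Qed.

Lemma residualB x y : g x - g y = A *m (x - y).
Proof. by rewrite /residual mulmxBr opprB addrA subrK. Qed.

Lemma residual_richardson x : g (q x) = g x - M *m g x.
Proof. by rewrite /richardson residualD -[b - _]opprB mulmxN mulmxN !mulmxA. Qed.

Lemma residual_ngmres_update x k l (beta : 'cV[R]_l.+1) :
  g (ngmres_update q x k beta) =
  g (q (x k)) + \sum_(i < l.+1) beta i 0 *: (g (q (x k)) - g (x (k - i)%N)).
Proof.
rewrite /ngmres_update residualD mulmx_sumr; congr (_ + _).
by apply: eq_bigr => i _; rewrite -scalemxAr residualB.
Qed.

Lemma ngmres_objectiveE x k l (beta : 'cV[R]_l.+1) :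
  ngmres_objective q g x k beta =
  dot (g (ngmres_update q x k beta)) (g (ngmres_update q x k beta)).
Proof. by rewrite residual_ngmres_update -norm2_sqr. Qed.

(** If the previous residuals are those of a Krylov method, NGMRES cannot leave
    the space over which GMRES minimises. *)
Lemma ngmres_update_krylov r0 x k l (beta : 'cV[R]_l.+1) :
  (forall j, (j <= k)%N -> exists2 z, z \in krylov M r0 j & g (x j) = r0 + M *m z) ->
  exists2 z, z \in krylov M r0 k.+1 &
    g (ngmres_update q x k beta) = r0 + M *m z.
Proof.
move=> hx.
have [zk Kzk gk] := hx k (leqnn k).
have Krk : g (x k) \in krylov M r0 k.+1 by rewrite gk krylov_residual.
have Kw : zk - g (x k) \in krylov M r0 k.+1.
  by rewrite rpredB // (krylov_mono _ Kzk).
have qE : g (q (x k)) = r0 + M *m (zk - g (x k)).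
  by rewrite residual_richardson [in RHS]mulmxBr addrA -gk.
move: (zk - _) Kw qE => w Kw qE; rewrite residual_ngmres_update qE.
have [z Kz ->] : exists2 z, z \in krylov M r0 k.+1 &
    \sum_(i < l.+1) beta i 0 *: (r0 + M *m w - g (x (k - i)%N)) = M *m z.
  apply: (big_ind (fun v => exists2 z, z \in krylov M r0 k.+1 & v = M *m z)).
  - by exists 0; rewrite ?mem0v ?mulmx0.
  - move=> _ _ [u Ku ->] [v Kv ->]; exists (u + v); last by rewrite mulmxDr.
    exact: memvD.
  move=> i _; have [z Kz ->] := hx (k - i)%N (leq_subr _ _).
  exists (beta i 0 *: (w - z)).
    by rewrite memvZ // rpredB // (krylov_mono _ Kz) // leqW ?leq_subr.
  by rewrite -scalemxAr shifted_image_sub.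
by exists (w + z); rewrite ?mulmxDr ?addrA // memvD.
Qed.

(** The combination of residuals is r_k - (1 + beta_0) M r_k when only beta_0
    is nonzero, hence the choice of beta_0. *)
Lemma ngmres_reach_line x k l s : exists beta : 'cV[R]_l.+1,
  g (ngmres_update q x k beta) = g (x k) + s *: (M *m g (x k)).
Proof.
exists (\col_i (if i == 0 :> nat then - s - 1 else 0)).
rewrite residual_ngmres_update big_ord_recl big1 => [|i _]; last first.
  by rewrite mxE /= scale0r.
rewrite !mxE /= subn0 residual_richardson; move: (M *m _) => v.
by apply/matrixP => i j; rewrite !mxE; ring.
Qed.

(** With beta_0 and beta_1 alone, the combination of residuals is
    r_k - (1 + beta_0 + beta_1) M r_k + beta_1 (r_k - r_(k-1)). *)
Lemma ngmres_reach_plane x k l s t : (0 < l)%N -> exists beta : 'cV[R]_l.+1,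
  g (ngmres_update q x k beta) =
  g (x k) + s *: (M *m g (x k)) + t *: (g (x k) - g (x k.-1)).
Proof.
case: l => // l _.
exists (\col_i (if i == 0 :> nat then - s - 1 - t
                else if i == 1 :> nat then t else 0)).
rewrite residual_ngmres_update !big_ord_recl big1 => [|i _]; last first.
  by rewrite mxE /= scale0r.
rewrite !mxE /= subn0 subn1 residual_richardson; move: (M *m _) => v.
by apply/matrixP => i j; rewrite !mxE; ring.
Qed.

End NGMRES.

(** * Equality of the iterates *)

Theorem theorem2p4 (R : realType) (n : nat) (A P : 'M[R]_n)
    (b x0 : 'cV[R]_n)
    (hA : A \in unitmx) (hP : P \in unitmx)
    (hAP : (A *m P)^T = A *m P \/
           exists (tau : R) (S : 'M[R]_n),
             S^T = - S /\ A *m P = tau *: 1%:M + S)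
    (xNG : nat -> nat -> 'cV[R]_n) (xGr : nat -> 'cV[R]_n)
    (hNG : forall m : nat, (0 < m)%N ->
       is_ngmres m (richardson A P b) (residual A b) x0 (xNG m))
    (hGr : is_right_gmres A P b x0 xGr)
    (kstar : nat) (hkstar : (0 < kstar)%N)
    (hres : residual A b (xGr kstar.-1) != 0)
    (hdecr : forall k : nat, (0 < k)%N -> (k < kstar)%N ->
       norm2 (residual A b (xGr k)) < norm2 (residual A b (xGr k.-1))) :
  forall m k : nat, (0 < m)%N -> (k <= kstar)%N -> xNG m k = xGr k.
Proof.
have [a [c MT]] : exists a c : R, (A *m P)^T = a *: (A *m P) + c%:M.
  case: hAP => [->|[tau [S [ST ->]]]].
    by exists 1, 0; rewrite scale1r raddf0 addr0.
  (* S^T = - S turns tau I + S into tau I - S = 2 tau I - (tau I + S). *)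
  exists (-1), (2 * tau); rewrite linearD /= linearZ /= trmx1 ST.
  by apply/matrixP => i j; rewrite !mxE; ring.
have [Gr0 GrS] := hGr; set r0 := residual A b x0 in GrS.
have hz k : exists2 z, is_minres (A *m P) r0 k z &
    residual A b (xGr k) = r0 + A *m P *m z.
  case: k => [|k].
    exists 0; last by rewrite Gr0 mulmx0 addr0.
    by split=> [|y /krylov0->]; [exact: mem0v|rewrite /dot !mulmx0 mxE].
  have [z [Kz zmin ->]] := GrS k.+1 isT; exists z; first exact: minresP.
  by rewrite residualD mulmxA.
move=> m k m_gt0; have [NG0 NGS] := hNG m m_gt0.
elim/ltn_ind: k => -[|k] IH lek; first by rewrite NG0 Gr0.
have eqx j : (j <= k)%N -> xNG m j = xGr j.
  by move=> lejk; apply: IH => //; exact: leq_trans lejk (ltnW lek).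
have [beta [bmin ->]] := NGS k; apply: (residual_inj (b := b) hA).
have [z'' hz'' ->] := hz k.+1.
have [y Ky yE] : exists2 y, y \in krylov (A *m P) r0 k.+1 &
    residual A b (ngmres_update (richardson A P b) (xNG m) k beta)
      = r0 + A *m P *m y.
  apply: ngmres_update_krylov => j /eqx->.
  by have [z [Kz _] zE] := hz j; exists z.
have [gamma gE] : exists gamma : 'cV_(minn k m).+1,
    residual A b (ngmres_update (richardson A P b) (xNG m) k gamma)
      = r0 + A *m P *m z''.
  case: k lek IH NGS eqx beta bmin hz'' yE Ky => [|k] lek _ _ eqx _ _ hz'' _ _.
    have [/memv_krylovS[_ /krylov0-> [s ->]] _] := hz''.
    have [gamma gE] := ngmres_reach_line A P b (xNG m) 0 (minn 0 m) s.
    by exists gamma; rewrite gE NG0 expr0 mul1mx add0r -scalemxAr.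
  have [[z hzk zE] [z' hz' zE']] := (hz k, hz k.+1).
  have dE : A *m P *m (z' - z) = residual A b (xGr k.+1) - residual A b (xGr k).
    by rewrite zE zE' shifted_image_sub.
  have dN0 : A *m P *m (z' - z) != 0.
    rewrite dE subr_eq0; apply: contraTneq (hdecr k.+1 isT lek) => -> /=.
    by rewrite ltxx.
  have [s [t ->]] := minres_three_term MT hzk hz' hz'' dN0.
  have m_k : (0 < minn k.+1 m)%N by rewrite leq_min.
  have [gamma gE] := ngmres_reach_plane A P b (xNG m) k.+1 s t m_k.
  by exists gamma; rewrite gE dE !eqx //= zE'.
rewrite yE; apply: (minres_unique hz'' Ky).
by have := bmin gamma; rewrite !ngmres_objectiveE gE yE.
Qed.
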